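(* Let $\psi:\mathbb{R}\times\mathbb{R}\to\mathbb{R}$, $(x,\theta)\mapsto\psi(x,\theta)$, be continuous and almost everywhere differentiable, let $\mathbf{x}=(x_1,\dots,x_N)\in\mathbb{R}^N$ be a given data set, and let $T_N=T_N(\mathbf{x})$ be the associated $M$-estimate, i.e. the solution of $\sum_{n=1}^N\psi(x_n,T_N)=0$. Then the adversarial influence function of the $M$-estimator at $\mathbf{x}$ is as follows. (i) For $p=1$, $$\text{AIF}(\psi,\mathbf{x},1)=\frac{\left|\frac{\partial\psi}{\partial x}(x_{n^*},T_N)\right|}{\left|\frac1N\sum_{n=1}^N\frac{\partial\psi}{\partial\theta}(x_n,T_N)\right|},\qquad n^*\in\arg\max_{1\le n\le N}\left|\frac{\partial\psi}{\partial x}(x_n,T_N)\right|.$$ (ii) For $p>1$, $$\text{AIF}(\psi,\mathbf{x},p)=\frac{\left(\frac1N\sum_{n=1}^N\left|\frac{\partial\psi}{\partial x}(x_n,T_N)\right|^{\frac{p}{p-1}}\right)^{\frac{p-1}{p}}}{\left|\frac1N\sum_{n=1}^N\frac{\partial\psi}{\partial\theta}(x_n,T_N)\right|}.$$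
   Context: $M$-estimator: for a data set $\mathbf{y}=(y_1,\dots,y_N)\in\mathbb{R}^N$, the estimate $T_N(\mathbf{y})\in\mathbb{R}$ is the solution $t$ of $\sum_{n=1}^N\psi(y_n,t)=0$; it is understood that $T_N$ is well defined by this equation (for each data set the equation has exactly one solution). Adversarial influence function (AIF): for $\eta>0$ and real $p\ge1$ let $\Delta T_N(\mathbf{x})$ be the optimal value (supremum) of $$\max_{\Delta\mathbf{x}\in\mathbb{R}^N}\ |T_N(\mathbf{x}+\Delta\mathbf{x})-T_N(\mathbf{x})|\quad\text{subject to}\quad \frac1N\|\Delta\mathbf{x}\|_p^p\le\eta^p,$$ where $\|\Delta\mathbf{x}\|_p^p=\sum_{n=1}^N|\Delta x_n|^p$. Then $$\text{AIF}(T_N,\mathbf{x},p)=\lim_{\eta\downarrow0}\frac{\Delta T_N(\mathbf{x})}{\eta},$$ and for the $M$-estimator defined by $\psi$ this is written $\text{AIF}(\psi,\mathbf{x},p)$. For the formulas to be meaningful, $\psi$ is understood to be differentiable at the points $(x_n,T_N)$, $n=1,\dots,N$, and $\sum_{n=1}^N\frac{\partial\psi}{\partial\theta}(x_n,T_N)\neq0$. *)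

(* Defs.v *)
From HB Require Import structures.
From mathcomp Require Import all_boot all_order all_algebra.
From mathcomp Require Import all_classical all_reals all_analysis.
Import Order.TTheory GRing.Theory Num.Theory.
Import numFieldNormedType.Exports.

Set Implicit Arguments.
Unset Strict Implicit.
Unset Printing Implicit Defensive.

Local Open Scope classical_set_scope.
Local Open Scope ring_scope.

(* The estimate is well defined for every data set of the fixed size N: the   *)
(* estimating equation has T y as its unique root.                            *)
Definition is_Mestimator (R : realType) (N : nat) (psi : R * R -> R)
    (T : 'rV[R]_N -> R) : Prop :=
  forall y : 'rV[R]_N, unique (fun t : R => \sum_(n < N) psi (y 0 n, t) = 0) (T y).

Definition perturbations (R : realType) (N : nat) (p eta : R) : set 'rV[R]_N :=
  [set dx | N%:R^-1 * \sum_(n < N) `|dx 0 n| `^ p <= eta `^ p].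

(* Valued in \bar R because the supremum may be +oo for large eta. *)
Definition adversarial_deviation (R : realType) (N : nat) (T : 'rV[R]_N -> R)
    (x : 'rV[R]_N) (p eta : R) : \bar R :=
  ereal_sup [set (`|T (x + dx) - T x|)%:E
                  | dx in perturbations p eta].

Definition adversarial_quotient (R : realType) (N : nat) (T : 'rV[R]_N -> R)
    (x : 'rV[R]_N) (p eta : R) : \bar R :=
  (adversarial_deviation T x p eta * (eta^-1)%:E)%E.

(* [lim] has a junk value when there is no limit, so statements about [AIF]   *)
(* should also assert [cvg] of the quotient.                                  *)
Definition AIF (R : realType) (N : nat) (T : 'rV[R]_N -> R)
    (x : 'rV[R]_N) (p : R) : \bar R :=
  lim (adversarial_quotient T x p eta @[eta --> 0^'+]).

Definition partial_x (R : realType) (psi : R * R -> R) (x t : R) : R :=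
  derive1 (fun u : R => psi (u, t)) x.

Definition partial_theta (R : realType) (psi : R * R -> R) (x t : R) : R :=
  derive1 (fun s : R => psi (x, s)) t.

(* Main.v *)
Require Import Defs.
From HB Require Import structures.
From mathcomp Require Import all_boot all_order all_algebra.
From mathcomp Require Import all_classical all_reals all_analysis.
From mathcomp Require Import ring lra.
Import Order.TTheory GRing.Theory Num.Theory.
Import numFieldNormedType.Exports.
Local Open Scope classical_set_scope.
Local Open Scope ring_scope.

(** The estimate is differentiable at the data set, and the adversary only sees
its differential.  Write a_n and b_n for the partial derivatives of psi in the
data and in the parameter at (x_n, T x), and D for the sum of the b_n.  Expanding
the estimating equation to first order suggests that a perturbation dx moves the
estimate by L dx = - (sum_n a_n dx_n) / D.

To prove this without an implicit function theorem (psi need not be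
differentiable at every point near the (x_n, T x)), evaluate the perturbed estimating
function at T x + L dx + e r and T x + L dx - e r, where r bounds the entries
of dx.  Up to an error o(r) the values are D e r and - D e r, so for small r they
have opposite signs; by continuity there is a root in between, and by uniqueness
that root is T (x + dx).  This is [mestimator_first_order]; it gives
continuity and differentiability of T at x in one stroke.

Every admissible perturbation of budget eta has entries at most N eta, so the
deviation divided by eta converges to the maximum of |L| over the budget set of
size one ([adversarial_quotient_cvg]).  That maximum is a normalised
dual norm of a, divided by |D / N|: for p = 1 the whole budget goes to an entry where |a_n| is
largest ([mean_dual_one_le], [mean_dual_one_eq]); for p > 1 it is the equality
case of Hoelder's inequality ([mean_dual_le], [mean_dual_eq]). *)

(** * First-order expansion of the estimate *)

Lemma diff_partial (R : realType) (f : R * R -> R) (x t u s : R) :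
  differentiable f (x, t) ->
  'd f (x, t) (u, s) = partial_x f x t * u + partial_theta f x t * s.
Proof.
move=> df.
have Ex h : (h *: (1, 0) + (x, t) : R * R) = (h *: 1 + x, t).
  by congr (_, _) => /=; rewrite scaler0 add0r.
have Et h : (h *: (0, 1) + (x, t) : R * R) = (x, h *: 1 + t).
  by congr (_, _) => /=; rewrite scaler0 add0r.
have Dx : partial_x f x t = 'D_(1, 0) f (x, t).
  rewrite /partial_x derive1E /derive.
  by under [in RHS]eq_fun do rewrite /= Ex.
have Dt : partial_theta f x t = 'D_(0, 1) f (x, t).
  rewrite /partial_theta derive1E /derive.
  by under [in RHS]eq_fun do rewrite /= Et.
rewrite Dx Dt !deriveE //.
have -> : (u, s) = u *: (1, 0) + s *: (0, 1) :> R * R.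
  by congr (_, _) => /=; rewrite !scaler0 ?addr0 ?add0r [_ *: _]mulr1.
by rewrite linearD !linearZ /= [_ *: _]mulrC [s *: _]mulrC.
Qed.

Lemma first_order_bound (R : realType) (f : R * R -> R) (x t e : R) :
  differentiable f (x, t) -> 0 < e ->
  \forall h \near (0 : R * R),
    `|f (x + h.1, t + h.2) - f (x, t)
      - (partial_x f x t * h.1 + partial_theta f x t * h.2)| <= e * `|h|.
Proof.
move=> df e0.
have /eqaddoP/(_ e e0) := diff_locally df.
apply: filterS => -[u s] /=.
by rewrite !fctE /= diff_partial // opprD addrA [x + u]addrC [t + s]addrC.
Qed.

(** The root of the perturbed equation is trapped between two points at distance
e * r from the linear prediction, where the estimating function takes opposite
signs.  The quantifier over r, rather than over the norm of dx, makes the bound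
uniform over all perturbations with entries at most r. *)
Lemma mestimator_first_order (R : realType) (N : nat) (psi : R * R -> R)
    (T : 'rV[R]_N -> R) (x : 'rV[R]_N)
    (D := \sum_(n < N) partial_theta psi (x 0 n) (T x)) :
  continuous psi -> is_Mestimator psi T ->
  (forall n : 'I_N, differentiable psi (x 0 n, T x)) -> D != 0 ->
  forall e : R, 0 < e -> exists2 d : R, 0 < d &
  forall (r : R) (dx : 'rV[R]_N), 0 < r -> r <= d ->
    (forall n, `|dx 0 n| <= r) ->
    `|T (x + dx) - T x + (\sum_(n < N) partial_x psi (x 0 n) (T x) * dx 0 n) / D|
      <= e * r.
Proof.
move=> psiC TM dpsi D0 e e0.
pose a n := partial_x psi (x 0 n) (T x); pose A := \sum_(n < N) `|a n|.
pose b n := partial_theta psi (x 0 n) (T x).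
have nD0 : 0 < `|D| by rewrite normr_gt0.
have A0 : 0 <= A by apply: sumr_ge0.
have AD0 : 0 <= A / `|D| by rewrite divr_ge0.
(* C * r bounds the data and parameter displacements used below, and e' is the
   accuracy for which N errors of size e' * (C * r) stay below |D| * e * r. *)
pose C := 1 + A / `|D| + e.
have C0 : 0 < C by rewrite /C; lra.
pose e' := `|D| * e / (N.+1%:R * C).
have e'0 : 0 < e' by rewrite /e' divr_gt0 ?mulr_gt0.
have /nbhs_norm0P[d /= d0 hd] : \forall h \near (0 : R * R), forall n : 'I_N,
    `|psi (x 0 n + h.1, T x + h.2) - psi (x 0 n, T x)
      - (a n * h.1 + b n * h.2)| <= e' * `|h|.
  exact: (filter_forall _ (fun n => first_order_bound _ _ _ _ _ (dpsi n) e'0)).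
exists (d / (2 * C)); first by rewrite divr_gt0 ?mulr_gt0.
move=> r dx r0; rewrite ler_pdivlMr ?mulr_gt0 // => rd dxr.
set S := \sum_(n < N) _; pose l := - (S / D).
have lr : `|l| <= A / `|D| * r.
  rewrite normrN normrM normfV mulrAC ler_wpM2r ?invr_ge0 //.
  rewrite /S (le_trans (ler_norm_sum _ _ _)) // mulr_suml ler_sum // => n _.
  by rewrite normrM ler_wpM2l.
pose g t := \sum_(n < N) psi ((x + dx) 0 n, t).
have gE s : `|s| <= C * r -> `|g (T x + s) - D * (s - l)| < `|D| * (e * r).
  move=> sC.
  have -> : g (T x + s) - D * (s - l) =
      \sum_(n < N) (psi (x 0 n + dx 0 n, T x + s) - psi (x 0 n, T x)
        - (a n * dx 0 n + b n * s)).
    rewrite !sumrB big_split /= (TM x).1 -mulr_suml -/S -/D subr0.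
    rewrite mulrBr /l mulrN opprK mulrCA divff // mulr1 [S + _]addrC.
    by congr (_ - _); apply: eq_bigr => n _; rewrite mxE.
  rewrite (le_lt_trans (ler_norm_sum _ _ _)) //.
  have hC (n : 'I_N) : `|(dx 0 n, s)| <= C * r.
    rewrite prod_normE /= ge_max sC andbT (le_trans (dxr n)) //.
    by rewrite ler_peMl ?ltW //; rewrite /C; lra.
  apply: (@le_lt_trans _ _ (\sum_(n < N) e' * (C * r))).
    apply: ler_sum => n _; apply: (le_trans (hd (dx 0 n, s) _ n)).
      by apply: (le_lt_trans (hC n)); nra.
    by rewrite ler_wpM2l // ltW.
  rewrite sumr_const card_ord -mulr_natl.
  have -> : N%:R * (e' * (C * r)) = N%:R / N.+1%:R * (`|D| * (e * r)).
    have : N.+1%:R != 0 :> R by [].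
    rewrite /e'; move: (N.+1%:R : R) (gt_eqF C0) => k /negbT C_neq0 k0.
    by field; rewrite k0.
  by rewrite gtr_pMl ?mulr_gt0 // ltr_pdivrMr // mul1r ltr_nat.
have er0 : 0 < e * r by rewrite mulr_gt0.
have lC s : `|s| <= e * r -> `|l + s| <= C * r.
  move=> se; apply: (le_trans (ler_normD _ _)); rewrite /C !mulrDl mul1r; lra.
(* At s = l + e r and s = l - e r the main term D * (s - l) dominates the error,
   so g changes sign between these two points, whichever sign D has. *)
have gp : `|g (T x + (l + e * r)) - D * (e * r)| < `|D| * (e * r).
  have := gE (l + e * r); rewrite [l + _ - l]addrAC subrr add0r; apply.
  by rewrite lC // gtr0_norm.
have gm : `|g (T x + (l - e * r)) + D * (e * r)| < `|D| * (e * r).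
  have := gE (l - e * r); rewrite [l - _ - l]addrAC subrr add0r mulrN opprK; apply.
  by rewrite lC // normrN gtr0_norm.
have gC : continuous g.
  move=> t; apply: cvg_big => [|n _]; first exact: add_continuous.
  apply: (@continuous_comp _ _ _ (fun t => ((x + dx) 0 n, t)) psi); last exact: psiC.
  exact: (cvg_pair (cvg_cst _) cvg_id).
have [|||c] := @IVT R g (T x + (l - e * r)) (T x + (l + e * r)) 0.
- lra.
- exact: continuous_subspaceT gC.
- move: gp gm; have [D_lt0|D_gt0|] := ltgtP D 0;
    last by move/eqP; rewrite (negPf D0).
  + rewrite (ltr0_norm D_lt0) !ltr_norml ge_min le_max => /andP[? ?] /andP[? ?].
    by apply/andP; split; apply/orP; [right|left]; lra.
  + rewrite (gtr0_norm D_gt0) !ltr_norml ge_min le_max => /andP[? ?] /andP[? ?].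
    by apply/andP; split; apply/orP; [left|right]; lra.
rewrite in_itv /= => /andP[c1 c2] gc0.
rewrite ((TM (x + dx)).2 _ gc0).
have -> : S / D = - l by rewrite opprK.
by rewrite ler_norml; apply/andP; split; lra.
Qed.

(** * From the differential to the limit of the quotient *)

(** A crude bound, but linear in eta: this is what makes an error o(r) in the
expansion an error o(eta), uniformly over the budget set. *)
Lemma perturbation_entry_le (R : realType) (N : nat) (p eta : R) (dx : 'rV[R]_N)
    (n : 'I_N) :
  1 <= p -> 0 < eta -> perturbations p eta dx -> `|dx 0 n| <= N%:R * eta.
Proof.
move=> p1 eta0; rewrite /perturbations /=.
have N1 : 1 <= N%:R :> R by rewrite ler1n (leq_trans _ (ltn_ord n)).
have N0 : 0 < N%:R :> R by rewrite (lt_le_trans _ N1).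
have p0 : 0 < p by lra.
rewrite mulrC ler_pdivrMr // => dxp.
rewrite leNgt; apply/negP => /(gt0_ltr_powR p0) lt_p.
have := lt_p _ _; rewrite !nnegrE mulr_ge0 ?normr_ge0 ?ltW // => /(_ isT isT).
apply/negP; rewrite -leNgt powRM ?(ltW N0) ?(ltW eta0) // mulrC.
apply: (@le_trans _ _ (eta `^ p * N%:R)).
  apply: le_trans dxp; rewrite (bigD1 n) //= lerDl.
  by apply: sumr_ge0 => i _; exact: powR_ge0.
rewrite ler_wpM2l ?powR_ge0 // -{1}[N%:R](@powRr1 R) //.
exact: ler_powR.
Qed.

(** The supremum defining the deviation stays within eps * eta of the maximum
K * eta of the linear part: the upper bound uses that K * eta dominates, the lower
bound that it is attained. *)
Lemma adversarial_quotient_cvg (R : realType) (N : nat) (T L : 'rV[R]_N -> R)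
    (x : 'rV[R]_N) (p K : R) :
  (0 < N)%N -> 1 <= p ->
  (forall e : R, 0 < e -> exists2 d : R, 0 < d &
    forall (r : R) (dx : 'rV[R]_N), 0 < r -> r <= d ->
      (forall n, `|dx 0 n| <= r) -> `|T (x + dx) - T x - L dx| <= e * r) ->
  (forall eta dx, 0 < eta -> perturbations p eta dx -> `|L dx| <= K * eta) ->
  (forall eta, 0 < eta -> exists2 dx, perturbations p eta dx & `|L dx| = K * eta) ->
  adversarial_quotient T x p eta @[eta --> 0^'+] --> K%:E.
Proof.
move=> N_gt0 p1 TL Lle Lmax.
have N0 : 0 < N%:R :> R by rewrite ltr0n.
have near_K eps : 0 < eps -> \forall eta \near 0^'+,
    ((K - eps)%:E <= adversarial_quotient T x p eta <= (K + eps)%:E)%E.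
  move=> eps0.
  (* The expansion is used with r = N eta, hence the accuracy eps / N. *)
  have [|d d0 dT] := TL (eps / N%:R); first by rewrite divr_gt0.
  near=> eta.
  have eta0 : 0 < eta by near: eta; exact: nbhs_right_gt.
  have etad : N%:R * eta <= d.
    rewrite mulrC -ler_pdivlMr //; near: eta.
    by apply: nbhs_right_le; rewrite divr_gt0.
  have Tapprox dx : perturbations p eta dx ->
      `|T (x + dx) - T x - L dx| <= eps * eta.
    have -> : eps * eta = eps / N%:R * (N%:R * eta) by rewrite mulrA divfK ?gt_eqF.
    move=> dxp.
    by apply: dT => [|//|n]; [rewrite mulr_gt0|exact: perturbation_entry_le dxp].
  rewrite /adversarial_quotient lee_pdivlMr // lee_pdivrMr // -!EFinM.
  apply/andP; split.
  - have [dx dxp Ldx] := Lmax _ eta0.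
    apply: le_trans (ereal_sup_ubound _); last by exists dx.
    rewrite lee_fin mulrBl -Ldx.
    have := Tapprox _ dxp; have := ler_distD (T (x + dx) - T x) (L dx) 0.
    by rewrite !subr0 distrC; lra.
  - apply: ge_ereal_sup => _ [dx dxp <-]; rewrite lee_fin mulrDl.
    have := Tapprox _ dxp; have := Lle _ _ eta0 dxp.
    by have := ler_distD (L dx) (T (x + dx) - T x) 0; rewrite !subr0; lra.
apply/fine_cvgP; split.
  near=> eta.
  have /andP[lo hi] :
      ((K - 1)%:E <= adversarial_quotient T x p eta <= (K + 1)%:E)%E.
    by near: eta; exact: near_K.
  by rewrite fin_numE gt_eqF ?lt_eqF // ?(le_lt_trans hi) ?(lt_le_trans _ lo)
    ?ltry ?ltNyr.
apply/cvgrPdist_le => eps eps0; near=> eta.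
have /andP[] : ((K - eps)%:E <= adversarial_quotient T x p eta <= (K + eps)%:E)%E.
  by near: eta; exact: near_K.
rewrite /=; case: (adversarial_quotient T x p eta) => [q| |] //=.
by rewrite !lee_fin => ? ?; rewrite ler_norml; apply/andP; split; lra.
Unshelve. all: by end_near.
Qed.

(** * Maximum of a linear functional over the budget set *)

Lemma mean_dual_one_le (R : realType) (N : nat) (a : 'I_N -> R) (m : 'I_N) (eta : R)
    (dx : 'rV[R]_N) :
  (forall n, `|a n| <= `|a m|) -> 0 < eta -> perturbations 1 eta dx ->
  `|N%:R^-1 * \sum_(n < N) a n * dx 0 n| <= `|a m| * eta.
Proof.
move=> am eta0; rewrite /perturbations /= powRr1 ?(ltW eta0) // => dxp.
rewrite normrM ger0_norm // (le_trans _ (ler_wpM2l _ dxp)) //.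
rewrite mulrCA ler_wpM2l // mulr_sumr (le_trans (ler_norm_sum _ _ _)) //.
by apply: ler_sum => n _; rewrite normrM powRr1 // ler_wpM2r.
Qed.

(** The whole budget N * eta goes to the entry m; this meets the preceding bound
when |a m| is the largest coefficient. *)
Lemma mean_dual_one_eq (R : realType) (N : nat) (a : 'I_N -> R) (m : 'I_N) (eta : R) :
  0 < eta -> exists2 dx : 'rV[R]_N, perturbations 1 eta dx &
  `|N%:R^-1 * \sum_(n < N) a n * dx 0 n| = `|a m| * eta.
Proof.
move=> eta0.
have N0 : N%:R != 0 :> R by rewrite pnatr_eq0 -lt0n (leq_trans _ (ltn_ord m)).
have sumD (F : 'I_N -> R) : (forall n, n != m -> F n = 0) -> \sum_n F n = F m.
  by move=> F0; rewrite (bigD1 m) //= big1 ?addr0.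
exists (\row_n ((n == m)%:R * (N%:R * eta))).
- rewrite /perturbations /= sumD => [|n /negPf nm]; last first.
    by rewrite mxE nm mul0r normr0 powR0 // oner_neq0.
  rewrite mxE eqxx mul1r !powRr1 ?(ltW eta0) // ger0_norm ?mulr_ge0 ?(ltW eta0) //.
  by rewrite mulKf.
- rewrite sumD => [|n /negPf nm]; last by rewrite mxE nm mul0r mulr0.
  by rewrite mxE eqxx mul1r mulrCA mulKf // normrM (gtr0_norm eta0).
Qed.

Lemma powR_div (R : realType) (u v r : R) :
  0 <= u -> 0 < v -> (u / v) `^ r = u `^ r / v `^ r.
Proof.
move=> u0 v0; rewrite powRM ?invr_ge0 ?(ltW v0) //; congr (_ * _).
by rewrite -powR_inv1 ?(ltW v0) // -powRrM mulN1r powRN.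
Qed.

(** Hoelder's inequality for the normalised sums, with conjugate exponent
q = p / (p - 1).  After scaling both factors to unit norm it is the average of the
pointwise Young inequalities. *)
Lemma mean_dual_le (R : realType) (N : nat) (a : 'I_N -> R) (p eta : R)
    (dx : 'rV[R]_N) :
  1 < p -> 0 < eta -> perturbations p eta dx ->
  `|N%:R^-1 * \sum_(n < N) a n * dx 0 n|
    <= (N%:R^-1 * \sum_(n < N) `|a n| `^ (p / (p - 1))) `^ ((p - 1) / p) * eta.
Proof.
move=> p1 eta0; rewrite /perturbations /= => dxp.
have p0 : 0 < p by lra.
have p1' : 0 < p - 1 by lra.
pose q := p / (p - 1).
have q0 : 0 < q by rewrite divr_gt0.
rewrite -/q; have -> : (p - 1) / p = q^-1 by rewrite invf_div.
have pq : q^-1 + p^-1 = 1 by rewrite /q; field; rewrite !gt_eqF.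
clearbody q.
set A := N%:R^-1 * \sum_(n < N) `|a n| `^ q.
have A0 : 0 <= A by rewrite mulr_ge0 // sumr_ge0 // => n _; exact: powR_ge0.
apply: (@le_trans _ _ (N%:R^-1 * \sum_(n < N) `|a n| * `|dx 0 n|)).
  rewrite normrM ger0_norm // ler_wpM2l // (le_trans (ler_norm_sum _ _ _)) //.
  by apply: ler_sum => n _; rewrite normrM.
have [A_eq0|A_neq0] := eqVneq A 0.
  have /eqP := A_eq0; rewrite mulf_eq0 invr_eq0 => /orP[/eqP N0|].
    by rewrite N0 invr0 mul0r mulr_ge0 ?powR_ge0 ?ltW.
  rewrite psumr_eq0 => [/allP a0|n _]; last exact: powR_ge0.
  rewrite big1 ?mulr0 ?mulr_ge0 ?powR_ge0 ?ltW // => n _.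
  have := a0 n (mem_index_enum _); rewrite implyTb powR_eq0 => /andP[/eqP -> _].
  by rewrite mul0r.
have Agt0 : 0 < A by rewrite lt_def A_neq0.
pose M := A `^ q^-1; rewrite -/M.
have M0 : 0 < M by rewrite powR_gt0.
have Mq : M `^ q = A by rewrite /M -powRrM mulVf ?gt_eqF // powRr1.
have etap0 : 0 < eta `^ p by rewrite powR_gt0.
rewrite -[M * eta]mul1r -ler_pdivrMr ?mulr_gt0 // -mulrA mulr_suml.
have young (n : 'I_N) : `|a n| * `|dx 0 n| / (M * eta)
    <= `|a n| `^ q * (A * q)^-1 + `|dx 0 n| `^ p * (eta `^ p * p)^-1.
  have := @conjugate_powR R (`|a n| / M) (`|dx 0 n| / eta) q p.
  rewrite !divr_ge0 ?(ltW M0) ?(ltW eta0) // => /(_ isT isT q0 p0 pq).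
  rewrite !powR_div // Mq.
  rewrite (invfM M eta) (invfM A q) (invfM (eta `^ p) p) mulrACA.
  by rewrite (mulrA _ A^-1) (mulrA _ (eta `^ p)^-1).
apply: (le_trans (ler_wpM2l _ (ler_sum _ (fun n _ => young n)))) => //.
rewrite big_split /= -!mulr_suml mulrDr !mulrA -/A -[in leRHS]pq lerD //.
  by rewrite (invfM A q) (mulrA A) divff // mul1r.
by rewrite (invfM _ p) mulrA ler_piMl ?invr_ge0 ?(ltW p0) //
  ler_pdivrMr // mul1r.
Qed.

(** The equality case of Hoelder's inequality: |dx_n|^p must be proportional to
|a_n|^q, with the signs of the a_n, so |dx_n| is proportional to
|a_n|^(q - 1). *)
Lemma mean_dual_eq (R : realType) (N : nat) (a : 'I_N -> R) (p eta : R) :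
  1 < p -> 0 < eta -> exists2 dx : 'rV[R]_N, perturbations p eta dx &
  `|N%:R^-1 * \sum_(n < N) a n * dx 0 n|
    = (N%:R^-1 * \sum_(n < N) `|a n| `^ (p / (p - 1))) `^ ((p - 1) / p) * eta.
Proof.
move=> p1 eta0.
have p0 : 0 < p by lra.
have p1' : 0 < p - 1 by lra.
pose q := p / (p - 1).
have q0 : 0 < q by rewrite divr_gt0.
rewrite -/q; have -> : (p - 1) / p = q^-1 by rewrite invf_div.
have pq : q^-1 + p^-1 = 1 by rewrite /q; field; rewrite !gt_eqF.
have qE : (q - 1) * p = q by rewrite /q; field; rewrite gt_eqF.
set A := N%:R^-1 * \sum_(n < N) `|a n| `^ q.
have A0 : 0 <= A by rewrite mulr_ge0 // sumr_ge0 // => n _; exact: powR_ge0.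
(* The constant that makes the mean of |dx_n|^p equal to eta^p, unless all the
   a_n vanish, in which case dx = 0. *)
pose c := eta * A `^ (- p^-1).
have c0 : 0 <= c by rewrite mulr_ge0 ?powR_ge0 ?ltW.
exists (\row_n (Num.sg (a n) * `|a n| `^ (q - 1) * c)).
- rewrite /perturbations /=.
  have dxE (n : 'I_N) : `|(\row_n (Num.sg (a n) * `|a n| `^ (q - 1) * c)) 0 n| `^ p
      = `|a n| `^ q * c `^ p.
    rewrite mxE normrM (ger0_norm c0) normrM normr_sg (ger0_norm (powR_ge0 _ _)).
    have [->|a0] := eqVneq (a n) 0.
      by rewrite normr0 mul0r mul0r !powR0 ?gt_eqF // mul0r.
    by rewrite mul1r powRM ?powR_ge0 // -powRrM qE.
  under eq_bigr do rewrite dxE.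
  rewrite -mulr_suml mulrA -/A /c powRM ?powR_ge0 ?(ltW eta0) //.
  rewrite -powRrM mulNr mulVf ?gt_eqF // powR_inv1 // mulrCA ler_piMr ?powR_ge0 //.
  by have [->|/divff ->] := eqVneq A 0; rewrite ?mul0r.
- have aE (n : 'I_N) : a n * (\row_n (Num.sg (a n) * `|a n| `^ (q - 1) * c)) 0 n
      = `|a n| `^ q * c.
    rewrite mxE !mulrA [a n * _]mulrC -normrEsg.
    have [->|a0] := eqVneq (a n) 0.
      by rewrite normr0 mul0r powR0 ?gt_eqF.
    congr (_ * _); rewrite -{1}[`|a n|](@powRr1 R) // -powRD ?[1 + _]addrC ?subrK //.
    by rewrite normr_eq0 a0 implybT.
  under eq_bigr do rewrite aE.
  rewrite -mulr_suml mulrA -/A (ger0_norm (mulr_ge0 A0 c0))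
    /c mulrCA [RHS]mulrC; congr (_ * _).
  have [->|An0] := eqVneq A 0; first by rewrite mul0r powR0 // invr_eq0 gt_eqF.
  rewrite -{1}[A](@powRr1 R) // -powRD ?An0 ?implybT //.
  by congr (_ `^ _); rewrite -pq addrK.
Qed.

(** * The adversarial influence function *)

(** Dividing numerator and denominator of the differential by N turns the
maximum M of the mean functional into the maximum M / |D / N| of |L|; the two
regimes of p differ only in the value of M. *)
Lemma mestimator_quotient_cvg (R : realType) (N : nat) (psi : R * R -> R)
    (T : 'rV[R]_N -> R) (x : 'rV[R]_N) (p M : R)
    (a := fun n => partial_x psi (x 0 n) (T x))
    (D := \sum_(n < N) partial_theta psi (x 0 n) (T x)) :
  (0 < N)%N -> continuous psi -> is_Mestimator psi T ->
  (forall n : 'I_N, differentiable psi (x 0 n, T x)) -> D != 0 -> 1 <= p ->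
  (forall eta (dx : 'rV[R]_N), 0 < eta -> perturbations p eta dx ->
    `|N%:R^-1 * \sum_(n < N) a n * dx 0 n| <= M * eta) ->
  (forall eta, 0 < eta -> exists2 dx : 'rV[R]_N, perturbations p eta dx &
    `|N%:R^-1 * \sum_(n < N) a n * dx 0 n| = M * eta) ->
  adversarial_quotient T x p eta @[eta --> 0^'+] --> (M / `|N%:R^-1 * D|)%:E.
Proof.
move=> N_gt0 psiC TM dpsi D0 p1 Mle Meq.
have Ni0 : N%:R^-1 != 0 :> R by rewrite invr_neq0 // pnatr_eq0 -lt0n.
have ND0 : 0 < `|N%:R^-1 * D| by rewrite normr_gt0 mulf_neq0.
pose L (dx : 'rV[R]_N) := - ((\sum_(n < N) a n * dx 0 n) / D).
have LE dx : `|L dx| = `|N%:R^-1 * \sum_(n < N) a n * dx 0 n| / `|N%:R^-1 * D|.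
  by rewrite normrN -normf_div -mulf_div divff // mul1r.
apply: (adversarial_quotient_cvg _ _ _ L) => // [e e0|eta dx eta0 dxp|eta eta0].
- have [d d0 dT] := mestimator_first_order _ _ _ _ _ psiC TM dpsi D0 _ e0.
  by exists d => // r dx r0 rd dxr; rewrite /L opprK; exact: dT.
- by rewrite LE mulrAC ler_wpM2r ?invr_ge0 //; exact: Mle.
- by have [dx dxp E] := Meq _ eta0; exists dx; rewrite // LE E mulrAC.
Qed.

Theorem theorem1 (R : realType) (N : nat) (psi : R * R -> R)
    (T : 'rV[R]_N -> R) (x : 'rV[R]_N)
    (N_gt0 : (0 < N)%N)
    (psi_cont : continuous psi)
    (psi_ae_diff : {ae (@lebesgue_measure R \x @lebesgue_measure R)%E,
                     forall z : R * R, differentiable psi z})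
    (T_Mest : is_Mestimator psi T)
    (psi_diff : forall n : 'I_N, differentiable psi (x 0 n, T x))
    (dtheta_neq0 : \sum_(n < N) partial_theta psi (x 0 n) (T x) != 0) :
  (cvg (adversarial_quotient T x 1 eta @[eta --> 0^'+]) /\
   forall nstar : 'I_N,
     (forall n : 'I_N, `|partial_x psi (x 0 n) (T x)|
                         <= `|partial_x psi (x 0 nstar) (T x)|) ->
     AIF T x 1 =
       (`|partial_x psi (x 0 nstar) (T x)|
        / `|N%:R^-1 * \sum_(n < N) partial_theta psi (x 0 n) (T x)|)%:E)
  /\
  (forall p : R, 1 < p ->
     cvg (adversarial_quotient T x p eta @[eta --> 0^'+]) /\
     AIF T x p =
       ((N%:R^-1 * \sum_(n < N) `|partial_x psi (x 0 n) (T x)| `^ (p / (p - 1)))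
          `^ ((p - 1) / p)
        / `|N%:R^-1 * \sum_(n < N) partial_theta psi (x 0 n) (T x)|)%:E).
Proof.
have cvg_AIF p K : adversarial_quotient T x p eta @[eta --> 0^'+] --> K%:E ->
    AIF T x p = K%:E by exact: cvg_lim.
have quotient_cvg := mestimator_quotient_cvg _ _ _ _ x _ _ N_gt0 psi_cont T_Mest
  psi_diff dtheta_neq0.
have quotient_cvg1 m : (forall n : 'I_N, `|partial_x psi (x 0 n) (T x)|
      <= `|partial_x psi (x 0 m) (T x)|) ->
    adversarial_quotient T x 1 eta @[eta --> 0^'+] -->
      (`|partial_x psi (x 0 m) (T x)|
        / `|N%:R^-1 * \sum_(n < N) partial_theta psi (x 0 n) (T x)|)%:E.
  move=> max_m; apply: quotient_cvg => // [eta dx|eta].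
  - exact: (mean_dual_one_le _ _ (fun n => partial_x psi (x 0 n) (T x))).
  - exact: (mean_dual_one_eq _ _ (fun n => partial_x psi (x 0 n) (T x))).
split; [split|].
- have [m _ max_m] := Order.TotalTheory.arg_maxP
    (fun n : 'I_N => `|partial_x psi (x 0 n) (T x)|)
    (isT : xpredT (Ordinal N_gt0)).
  by apply/cvg_ex; eexists; apply: (quotient_cvg1 m) => n; exact: max_m.
- by move=> m max_m; apply: cvg_AIF; exact: quotient_cvg1.
- move=> p p1.
  have p_cvg := quotient_cvg p _ (ltW p1)
    (fun eta dx => mean_dual_le _ _ (fun n => partial_x psi (x 0 n) (T x)) _ _ dx p1)
    (fun eta => mean_dual_eq _ _ (fun n => partial_x psi (x 0 n) (T x)) _ eta p1).
  by split; [apply/cvg_ex; eexists; exact: p_cvg|exact: cvg_AIF].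
Qed.
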